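(* Let $I\subset S=K[x_1,\ldots,x_n]$ be a nonzero monomial ideal. The following are equivalent: (1) $I$ is an ideal of Borel type. (2) $I_{\geq \mathrm{reg}(I)}$ is stable. (3) There exists an integer $e\geq \deg(I)$ such that $I_{\geq e}$ is stable. Moreover, if $I$ is an ideal of Borel type, or $I_{\geq \mathrm{reg}(I)}$ is stable, or there exists an integer $e\geq \deg(I)$ such that $I_{\geq e}$ is stable, then $\mathrm{reg}(I)=\min\{e \mid e\geq \deg(I),\ I_{\geq e} \text{ is stable}\}$.
   Context: $K$ is an infinite field, $n\geq 2$, and $S=K[x_1,\ldots,x_n]$ is the polynomial ring with its standard grading. A monomial ideal $I\subset S$ is of Borel type if $(I:x_j^\infty)=(I:(x_1,\ldots,x_j)^\infty)$ for all $j=1,\ldots,n$, where $(I:L^\infty)=\bigcup_{k\ge 1}(I:L^k)$ for an ideal $L$ and $(I:x_j^\infty)=(I:(x_j)^\infty)$. $G(I)$ denotes the minimal set of monomial generators of $I$, and $\deg(I)$ is the highest degree of a monomial in $G(I)$. For an integer $e$, $I_{\geq e}$ is the ideal generated by the monomials of $I$ of degree at least $e$. For a monomial $u$, $m(u)=\max\{i : x_i\mid u\}$ (with $m(1)=0$). A monomial ideal $L$ is stable if for every monomial $u\in L$ and every $1\le j<m(u)$ one has $x_j u/x_{m(u)}\in L$. The (Castelnuovo-Mumford) regularity of $I$ is $\mathrm{reg}(I)=\max\{j-i : \beta_{ij}(I)\neq 0\}$, where $\beta_{ij}(I)=\dim_K \mathrm{Tor}_i^S(I,K)_j$ are the graded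 Betti numbers. *)

(* Defs.v *)
From HB Require Import structures.
From mathcomp Require Import all_boot all_order all_algebra.
From mathcomp Require Import mpoly.
From Stdlib Require Import ClassicalEpsilon.

Set Implicit Arguments.
Unset Strict Implicit.
Unset Printing Implicit Defensive.

Import Order.TTheory GRing.Theory Num.Theory.
Local Open Scope ring_scope.

Definition infinite_type (T : eqType) : Prop :=
  forall s : seq T, exists x : T, x \notin s.

Definition is_maxz (P : int -> Prop) (z : int) : Prop :=
  P z /\ forall y, P y -> y <= z.

Definition is_minz (P : int -> Prop) (z : int) : Prop :=
  P z /\ forall y, P y -> z <= y.

(* Unspecified if P has no maximum. *)
Definition maxz (P : int -> Prop) : int := epsilon (inhabits 0) (is_maxz P).

(* Subsets of S = K[x_1, ..., x_n], in particular ideals (possibly S itself),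
   are predicates {mpoly K[n]} -> Prop; the variable x_{i+1} is 'X_i,
   i : 'I_n. *)

Section Ideals.
Context (K : fieldType) (n : nat).
Local Notation S := {mpoly K[n]}.

Definition ideal_gen (G : S -> Prop) (p : S) : Prop :=
  exists2 s : seq (S * S),
    forall c, c \in s -> G c.2 & p = \sum_(c <- s) c.1 * c.2.

Definition mono_gens (I : S -> Prop) (A : 'X_{1..n} -> Prop) : Prop :=
  forall p, I p <-> ideal_gen (fun q => exists2 m, A m & q = 'X_[m]) p.

Definition monomial_ideal (I : S -> Prop) : Prop :=
  exists A, mono_gens I A.

Definition min_mono_gens (I : S -> Prop) (A : 'X_{1..n} -> Prop) : Prop :=
  mono_gens I A /\
  forall B, (forall m, B m -> A m) -> mono_gens I B -> forall m, A m -> B m.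

(* A monomial ideal has exactly one minimal set of monomial generators; it is
   recovered here as the union of all of them. *)
Definition mingens (I : S -> Prop) (m : 'X_{1..n}) : Prop :=
  exists2 A, min_mono_gens I A & A m.

Definition ideal_deg (I : S -> Prop) : int :=
  maxz (fun d => exists2 m, mingens I m & d = (mdeg m)%:Z).

Definition ideal_pow (L : S -> Prop) (k : nat) : S -> Prop :=
  ideal_gen (fun q => exists2 f : 'I_k -> S,
    forall i, L (f i) & q = \prod_(i < k) f i).

Definition colon (I L : S -> Prop) (p : S) : Prop :=
  forall q, L q -> I (p * q).

Definition saturation (I L : S -> Prop) (p : S) : Prop :=
  exists2 k, (1 <= k)%N & colon I (ideal_pow L k) p.

Definition var_ideal (P : pred 'I_n) : S -> Prop :=
  ideal_gen (fun q => exists2 i, P i & q = 'X_i).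

Definition borel_type (I : S -> Prop) : Prop :=
  forall (j : 'I_n) (p : S),
    saturation I (var_ideal (pred1 j)) p <->
    saturation I (var_ideal (fun i : 'I_n => (i <= j)%N)) p.

Definition trunc_ge (I : S -> Prop) (e : int) : S -> Prop :=
  ideal_gen (fun q => exists m : 'X_{1..n},
    [/\ I 'X_[m], e <= (mdeg m)%:Z & q = 'X_[m]]).

(* m(u), numbering the variables from 1, so that max_var 0 = 0 is m(1). *)
Definition max_var (u : 'X_{1..n}) : nat :=
  (\max_(i < n | 0 < u i) i.+1)%N.

Definition stable (L : S -> Prop) : Prop :=
  forall (u : 'X_{1..n}) (j k : 'I_n),
    L 'X_[u] -> max_var u = k.+1 -> (j < k)%N -> L 'X_[(U_(j) + u - U_(k))%MM].

(* Graded free resolutions of I by modules of finite rank,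
     ... -> F_2 -> F_1 -> F_0 -> I -> 0,   F_i = \bigoplus_a S(- gfr_deg i a),
   elements of F_i being row vectors of coordinates. The resolution need be
   neither minimal nor of finite length. An entry which is zero satisfies the
   homogeneity conditions vacuously. *)
Record gfree_resolution (I : S -> Prop) := GFreeResolution {
  gfr_rank : nat -> nat;
  gfr_deg : forall i, 'I_(gfr_rank i) -> int;
  gfr_aug : 'cV[S]_(gfr_rank 0);
  gfr_dif : forall i, 'M[S]_(gfr_rank i.+1, gfr_rank i);
  gfr_aug_homog : forall a m,
    m \in msupp (gfr_aug a 0) -> (mdeg m)%:Z = gfr_deg a;
  gfr_dif_homog : forall i a b m,
    m \in msupp (gfr_dif i a b) -> (mdeg m)%:Z = gfr_deg a - gfr_deg b;
  gfr_aug_im : forall p,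
    I p <-> exists v : 'rV[S]_(gfr_rank 0), p = (v *m gfr_aug) 0 0;
  gfr_aug_exact : forall v : 'rV[S]_(gfr_rank 0),
    v *m gfr_aug = 0 <-> exists w : 'rV[S]_(gfr_rank 1), v = w *m gfr_dif 0;
  gfr_dif_exact : forall i (v : 'rV[S]_(gfr_rank i.+1)),
    v *m gfr_dif i = 0 <->
    exists w : 'rV[S]_(gfr_rank i.+2), v = w *m gfr_dif i.+1
}.

Arguments gfr_rank {I} F i : rename.
Arguments gfr_deg {I} F i a : rename.
Arguments gfr_aug {I} F : rename.
Arguments gfr_dif {I} F i : rename.

(* Tor_i^S(I, K)_j is the homology at F_i (x)_S K, in degree j, of the complex
   F (x)_S K (without the augmentation). Here F_i (x)_S K = K^(gfr_rank i),
   with the a-th basis vector in degree gfr_deg i a, and as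
   K = S / (x_1, ..., x_n) the differentials become the matrices of constant
   terms. *)
Section Betti.
Context (I : S -> Prop) (F : gfree_resolution I).

Definition tensor_dif (i : nat) : 'M[K]_(gfr_rank F i.+1, gfr_rank F i) :=
  map_mx (fun p : S => p@_0%MM) (gfr_dif F i).

(* The row space is the degree j component of F_i (x)_S K. *)
Definition tensor_comp (i : nat) (j : int) : 'M[K]_(gfr_rank F i) :=
  diag_mx (\row_a (gfr_deg F i a == j)%:R).

Definition tensor_ker (i : nat) : 'M[K]_(gfr_rank F i) :=
  match i with
  | 0 => 1%:M
  | i'.+1 => kermx (tensor_dif i')
  end.

Definition tor_cycles (i : nat) (j : int) : 'M[K]_(gfr_rank F i) :=
  (tensor_comp i j :&: tensor_ker i)%MS.

Definition tor_boundaries (i : nat) (j : int) :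
    'M[K]_(gfr_rank F i.+1, gfr_rank F i) :=
  tensor_comp i.+1 j *m tensor_dif i.

Definition betti (i : nat) (j : int) : nat :=
  (\rank (tor_cycles i j) - \rank (tor_boundaries i j))%N.

Definition reg : int :=
  maxz (fun d => exists i j, betti i j <> 0%N /\ d = j - i%:Z).

End Betti.

End Ideals.

Arguments gfr_rank {K n I} F i : rename.
Arguments gfr_deg {K n I} F i a : rename.
Arguments gfr_aug {K n I} F : rename.
Arguments gfr_dif {K n I} F i : rename.

(* Main.v *)
(* A graded Betti number [betti F i d] vanishes iff the Koszul homology of [I]
   does: shifting along the syzygies [Z_p] of [F], the Koszul homology
   H_i(x; I) becomes the kernel of Z_{i-1} / m Z_{i-1} -> F_{i-1} / m F_{i-1},
   which is also Tor_i computed from [F].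

   If [I_{>= e}] is stable and [e >= deg I], then dividing a monomial of [I] of
   degree [> e] by its last variable stays in [I], so contracting Koszul cycles
   with that variable shows [reg I <= e].  Conversely, let [I] be of Borel type
   and [r = reg I]; if [u] in [I_{>= r}] has last variable [x_k] but
   [w = x_j u / x_k] is not in [I], then some power of each of x_1, ..., x_k
   multiplies [w] into [I], so [w] divides a socle monomial [v] of
   K[x_1, ..., x_k] / I, and the boundary of v e_1 /\ ... /\ e_k gives a nonzero
   Tor_{k-1}(I, K) in degree [deg v + k], whence [reg I > deg v >= r].  Finally,
   when [I_{>= e}] is stable, replacing variables beyond [x_i] by [x_i] stays in
   [I], which yields Borel type. *)

Require Import Defs.
From HB Require Import structures.
From mathcomp Require Import all_boot all_order all_algebra.
From mathcomp Require Import mpoly zify ring.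
From Stdlib Require Import Classical ClassicalEpsilon.

Set Implicit Arguments.
Unset Strict Implicit.
Unset Printing Implicit Defensive.

Import Order.TTheory GRing.Theory Num.Theory.
Local Open Scope ring_scope.

(** * Selecting monomials of a polynomial and dividing by a variable *)

Section Polynomials.
Context (K : fieldType) (n : nat).
Local Notation S := {mpoly K[n]}.
Implicit Types (p q : S) (u m : 'X_{1..n}) (x : 'I_n).

Definition psel (P : pred 'X_{1..n}) p : S :=
  \sum_(m <- msupp p | P m) p@_m *: 'X_[m].

Lemma mcoeff_psel P p m : (psel P p)@_m = if P m then p@_m else 0.
Proof.
rewrite /psel big_mkcond raddf_sum /=.
rewrite (eq_bigr (fun u => (u == m)%:R * (if P m then p@_m else 0))); last first.
  move=> u _; case: eqP => [->|/eqP/negbTE ne]; rewrite ?mul1r ?mul0r; case: (P _);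
  by rewrite ?mcoeff0 // mcoeffZ mcoeffX ?eqxx ?mulr1 // ne mulr0.
rewrite -mulr_suml; case: (boolP (m \in msupp p)) => [mp|/memN_msupp_eq0->].
  rewrite (bigD1_seq m) //= ?msupp_uniq // eqxx big1 ?addr0 ?mul1r //.
  by move=> u /negbTE->.
by rewrite if_same mulr0.
Qed.

Lemma mem_msupp_psel P p m : (m \in msupp (psel P p)) = P m && (m \in msupp p).
Proof. by rewrite !mcoeff_msupp mcoeff_psel; case: (P m); rewrite ?eqxx. Qed.

Lemma psel0 P : psel P 0 = 0.
Proof. by apply/mpolyP => m; rewrite mcoeff_psel mcoeff0 if_same. Qed.

Lemma pselD P p q : psel P (p + q) = psel P p + psel P q.
Proof.
by apply/mpolyP => m; rewrite mcoeffD !mcoeff_psel mcoeffD; case: (P m); rewrite ?addr0.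
Qed.

Lemma pselN P p : psel P (- p) = - psel P p.
Proof.
by apply/mpolyP => m; rewrite mcoeffN !mcoeff_psel mcoeffN; case: (P m); rewrite ?oppr0.
Qed.

Lemma psel_sum (T : Type) (r : seq T) (P : pred 'X_{1..n}) (F : T -> S) :
  psel P (\sum_(i <- r) F i) = \sum_(i <- r) psel P (F i).
Proof.
by elim: r => [|i r IH]; rewrite ?big_nil ?psel0 // !big_cons pselD IH.
Qed.

Lemma psel_id (P : pred 'X_{1..n}) p : (forall m, m \in msupp p -> P m) -> psel P p = p.
Proof.
move=> h; apply/mpolyP => m; rewrite mcoeff_psel; case: ifP => // /negbT Pm.
by rewrite memN_msupp_eq0 //; apply: contra Pm => /h.
Qed.

Lemma eq_psel0 (P : pred 'X_{1..n}) p : (forall m, m \in msupp p -> ~~ P m) -> psel P p = 0.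
Proof.
move=> h; apply/mpolyP => m; rewrite mcoeff_psel mcoeff0; case: ifP => // Pm.
by rewrite memN_msupp_eq0 //; apply/negP => /h; rewrite Pm.
Qed.

Definition pdiv x p : S :=
  \sum_(m <- msupp p | (0 < m x)%N) p@_m *: 'X_[(m - U_(x))%MM].

Lemma psel_pdiv x p : psel (fun m => m x == 0)%N p + 'X_x * pdiv x p = p.
Proof.
rewrite {3}(mpolyE p) (bigID (fun m => m x == 0)%N) /=; congr (_ + _).
rewrite /pdiv mulr_sumr; apply: eq_big => m; rewrite lt0n // => mx; rewrite -scalerAr -mpolyXD; congr (_ *: 'X_[_]).
apply/mnmP => i; rewrite mnmDE mnmBE mnm1E addnC subnK //.
by case: eqP => [<-|//]; rewrite lt0n.
Qed.

Lemma mcoeffXM x p m : ('X_x * p)@_(U_(x) + m)%MM = p@_m.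
Proof. by rewrite mulrC mcoeffMX. Qed.

Lemma mcoeffXM0 x p m : (m x = 0)%N -> ('X_x * p)@_m = 0.
Proof.
move=> mx; apply: memN_msupp_eq0; apply/negP.
rewrite mulrC (perm_mem (msuppMX _ _)) => /mapP[u _ e].
by move: mx; rewrite e mnmDE mnm1E eqxx.
Qed.

Lemma mcoeff_pdiv x p m : (pdiv x p)@_m = p@_(U_(x) + m)%MM.
Proof.
rewrite -[p in RHS](psel_pdiv x) mcoeffD mcoeffXM mcoeff_psel.
by rewrite mnmDE mnm1E eqxx add0r.
Qed.

Lemma mcoeffXM_lt x p m : (0 < m x)%N -> ('X_x * p)@_m = p@_(m - U_(x))%MM.
Proof.
move=> mx; rewrite -(mcoeffXM x p); congr (_ @_ _); apply/mnmP => i.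
by rewrite mnmDE mnmBE mnm1E subnKC //; case: eqP => [<-|].
Qed.

End Polynomials.

(** * The Koszul complex and its acyclicity *)

Section Koszul.
Context (K : fieldType) (n : nat).
Local Notation S := {mpoly K[n]}.

(* A Koszul chain assigns to each [s] the coefficient of the wedge of the
   [e_x], [x] in [s]; the recursion is that of an iterated mapping cone. *)
Fixpoint kd (M : lmodType S) (xs : seq 'I_n) (c : {set 'I_n} -> M)
    (s : {set 'I_n}) : M :=
  if xs is x :: xs' then
    if x \in s then - kd xs' c s else kd xs' c s + ('X_x : S) *: c (x |: s)
  else 0.

Section Module.
Context (M : lmodType S).
Implicit Types (c : {set 'I_n} -> M) (s t : {set 'I_n}) (xs : seq 'I_n).

Lemma eq_kd xs c c' s :
  (forall x, x \in xs -> x \notin s -> c (x |: s) = c' (x |: s)) -> kd xs c s = kd xs c' s.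
Proof.
elim: xs => //= x xs IH e; rewrite IH => [|y yxs]; last by apply: e; rewrite inE yxs orbT.
by case: ifP => // /negbT xs'; rewrite e ?inE ?eqxx.
Qed.

Lemma kdD xs c c' s : kd xs (fun t => c t + c' t) s = kd xs c s + kd xs c' s.
Proof.
elim: xs => [|x xs IH] /=; first by rewrite addr0.
by rewrite IH; case: ifP => _; rewrite ?opprD // scalerDr addrACA.
Qed.

Lemma kdN xs c s : kd xs (fun t => - c t) s = - kd xs c s.
Proof.
elim: xs => [|x xs IH] /=; first by rewrite oppr0.
by rewrite IH; case: ifP => _; rewrite ?opprD // scalerN.
Qed.

Lemma kdB xs c c' s : kd xs (fun t => c t - c' t) s = kd xs c s - kd xs c' s.
Proof. by rewrite kdD kdN. Qed.

Lemma kd0 xs c s : (forall t, c t = 0) -> kd xs c s = 0.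
Proof.
move=> c0; elim: xs => [//|x xs IH] /=.
by rewrite IH c0 scaler0 oppr0 addr0 if_same.
Qed.

Lemma kdZ xs (a : S) c s : kd xs (fun t => a *: c t) s = a *: kd xs c s.
Proof.
elim: xs => [|x xs IH] /=; first by rewrite scaler0.
by rewrite IH; case: ifP => _; rewrite ?scalerN // scalerDr !scalerA mulrC.
Qed.

Lemma kd_setU1 xs x c s : x \notin xs ->
  kd xs (fun t => c (x |: t)) s = kd xs c (x |: s).
Proof.
elim: xs => [//|y xs IH] /=; rewrite inE negb_or => /andP[xy xxs].
by rewrite IH // in_setU1 eq_sym (negbTE xy) /= setUCA.
Qed.

Lemma kdK xs c s : uniq xs -> kd xs (kd xs c) s = 0.
Proof.
elim: xs s => [//|x xs IH] s /= /andP[xxs uxs].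
case: ifP => xs'.
  rewrite (eq_kd (c' := fun t => - kd xs c t)); first by rewrite kdN IH ?oppr0.
  by move=> y _ _; rewrite in_setU1 xs' orbT.
rewrite setU11.
rewrite (eq_kd (c' := fun t => kd xs c t + ('X_x : S) *: c (x |: t))); last first.
  move=> y yxs _; rewrite in_setU1 xs' orbF; case: eqP => // e.
  by rewrite e yxs in xxs.
by rewrite kdD IH // add0r (kdZ xs 'X_x (fun t => c (x |: t))) kd_setU1 // scalerN subrr.
Qed.

End Module.

Lemma kd_linear (M N : lmodType S) (f : {linear M -> N}) xs (c : {set 'I_n} -> M) s :
  f (kd xs c s) = kd xs (fun t => f (c t)) s.
Proof.
elim: xs => [|x xs IH] /=; first by rewrite raddf0.
by case: ifP => _; rewrite ?raddfN ?raddfD /= IH // linearZ.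
Qed.

Lemma kd_mulmx r r' (A : 'M[S]_(r, r')) xs (c : {set 'I_n} -> 'rV[S]_r) s :
  kd xs (fun t => c t *m A) s = kd xs c s *m A.
Proof. exact: (esym (kd_linear (mulmxr A) _ _ _)). Qed.

Lemma mcoeff_kd r (xs : seq 'I_n) (c : {set 'I_n} -> 'rV[S]_r) (s : {set 'I_n}) a m :
  (forall x, x \in xs -> x \notin s -> ('X_x * c (x |: s) 0 a)@_m = 0) ->
  (kd xs c s 0 a)@_m = 0.
Proof.
elim: xs => [|x xs IH] h /=; first by rewrite mxE mcoeff0.
have {}IH := IH (fun y yxs => h y (mem_behead (s := x :: xs) yxs)).
case: ifP => [_|/negbT xs']; rewrite !mxE ?mcoeffN ?mcoeffD IH ?oppr0 // add0r.
by rewrite h ?mem_head.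
Qed.

(** Only the term of [x] survives; it picks up a factor -1 for each element of [s] that precedes [x]
    in [xs]. *)
Lemma mcoeff_kd1 r (xs : seq 'I_n) (c : {set 'I_n} -> 'rV[S]_r) x (s : {set 'I_n}) a m :
  x \in xs -> x \notin s -> uniq xs ->
  (forall y, y \in xs -> y \notin s -> y != x -> ('X_y * c (y |: s) 0 a)@_m = 0) ->
  exists e : nat, (kd xs c s 0 a)@_m = (-1) ^+ e * ('X_x * c (x |: s) 0 a)@_m.
Proof.
move=> xxs xs' uxs h; elim: xs xxs uxs h => [//|y xs IH] /=.
rewrite inE => /orP[/eqP<-|xxs] /andP[yxs uxs] h.
  exists 0%N; rewrite (negbTE xs') !mxE expr0 mul1r mcoeffD mcoeff_kd ?add0r //.
  move=> z zxs zs; apply: h => //; first by rewrite inE zxs orbT.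
  by apply: contraNneq yxs => <-.
have [|e IHe] := IH xxs uxs; first by move=> z zxs; apply: h; rewrite inE zxs orbT.
case: ifP => [_|/negbT ys].
  by exists e.+1; rewrite mxE mcoeffN IHe exprS mulN1r mulNr.
have yx : y != x by apply: contraNneq yxs => ->.
by exists e; rewrite !mxE mcoeffD IHe (h y) ?addr0 ?mem_head.
Qed.

(* Kill the part of [z] divisible by the largest variable [x] with the
   contraction [e_x /\ _ / x]; the cycle condition then confines the rest to
   the remaining variables. *)
Lemma koszul_acyclic (r : nat) (P Q : 'I_r -> 'X_{1..n} -> Prop) (xs : seq 'I_n)
    (z : {set 'I_n} -> 'rV[S]_r) :
  sorted (fun x y : 'I_n => y < x)%N xs ->
  (forall a u (k : 'I_n), P a u -> (0 < u k)%N ->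
     (forall i : 'I_n, 0 < u i -> i <= k)%N -> Q a (u - U_(k))%MM) ->
  (forall s a u, u \in msupp (z s 0 a) -> P a u) ->
  (forall s a u (i : 'I_n), u \in msupp (z s 0 a) -> (0 < u i)%N -> i \in xs) ->
  (forall s, kd xs z s = 0) ->
  (forall (s : {set 'I_n}) a, {in xs, forall x, x \notin s} -> (z s 0 a)@_0 = 0) ->
  exists2 b : {set 'I_n} -> 'rV[S]_r,
    (forall s a u, u \in msupp (b s 0 a) -> Q a u) & forall s, z s = kd xs b s.
Proof.
move=> + PQ; elim: xs z => [|x xs IH] z sxs Pz xz cz z0.
  exists (fun=> 0) => [s a u|s /=]; first by rewrite mxE msupp0.
  apply/rowP => a; rewrite mxE; apply/mpolyP => u; rewrite mcoeff0.
  apply: memN_msupp_eq0; apply/negP => uz.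
  (* With no variable left the monomial is 1, which [z0] excludes. *)
  have u0 : u = 0%MM.
    apply/mnmP => i; rewrite mnm0E; apply/eqP; rewrite -leqn0 leqNgt.
    by apply/negP => /(xz _ _ _ _ uz).
  by move: uz; rewrite u0 mcoeff_msupp z0 ?eqxx.
have ltx : forall y, y \in xs -> (y < x)%N.
  move: (sxs); rewrite /= path_sortedE; last by move=> i j k ij /ltn_trans; apply.
  by case/andP => /allP h _ y /h.
have xxs : x \notin xs by apply/negP => /ltx; rewrite ltnn.
pose y s := map_mx (pdiv x) (z s).
pose z' s := map_mx (psel (fun m => m x == 0)%N) (z s).
have zE s : z s = z' s + ('X_x : S) *: y s.
  by apply/rowP => a; rewrite !mxE psel_pdiv.
(* [b1] is e_x /\ (z / x); on sets without [x], subtracting its boundary removes exactly the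
   multiples of [x] from [z]. *)
pose b1 (s : {set 'I_n}) := if x \in s then y (s :\ x) else 0.
pose z2 (s : {set 'I_n}) : 'rV[S]_r := z s - kd (x :: xs) b1 s.
have z2N (s : {set 'I_n}) : x \notin s -> z2 s = z' s.
  move=> xs'; rewrite /z2 /= (negbTE xs') /b1 setU11 setU1K // {1}zE.
  rewrite -/b1 [kd xs b1 s](_ : _ = 0) ?add0r ?addrK //.
  rewrite (eq_kd (c' := fun=> 0)) ?kd0 // => w wxs _.
  rewrite /b1 in_setU1 (negbTE xs') orbF; case: eqP => // e.
  by rewrite e wxs in xxs.
have uxs : uniq (x :: xs).
  apply: (sorted_uniq _ _ sxs) => [i j k ij /ltn_trans|i]; first exact.
  by rewrite ltnn.
have cz2 s : kd (x :: xs) z2 s = 0 by rewrite kdB cz kdK // subr0.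
(* The cycle condition at [s] adds [kd xs z2 s], whose monomials avoid [x], to a multiple of [x]; so
   both vanish. *)
have z2x (s : {set 'I_n}) : x \notin s -> z2 (x |: s) = 0 /\ kd xs z2 s = 0.
  move=> xs'; have := cz2 s; rewrite /= (negbTE xs') => e.
  have c0 (a : 'I_r) (u : 'X_{1..n}) : (u x = 0)%N \/ (kd xs z2 s 0 a)@_u = 0.
    case: (posnP (u x)) => ux; [by left|right].
    apply: mcoeff_kd => w wxs ws; have wx : w != x by apply: contraNneq xxs => <-.
    case: (posnP (u w)) => uw; first by rewrite mcoeffXM0.
    rewrite mcoeffXM_lt // z2N ?in_setU1 ?negb_or 1?eq_sym ?wx // mxE mcoeff_psel.
    by rewrite mnmBE mnm1E (negbTE wx) subn0 eqn0Ngt ux.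
  have k0 : kd xs z2 s = 0.
    apply/rowP => a; apply/mpolyP => u; rewrite mxE mcoeff0.
    case: (c0 a u) => // ux; move/rowP/(_ a): e; rewrite !mxE => /mpolyP/(_ u).
    by rewrite mcoeffD mcoeff0 (mcoeffXM0 _ ux) addr0.
  split=> //; move: e; rewrite k0 add0r => /rowP e; apply/rowP => a.
  move: (e a); rewrite !mxE => /eqP; rewrite mulf_eq0 => /orP[/eqP X0|/eqP //].
  have := mcoeffX K (U_(x)) U_(x); rewrite X0 mcoeff0 eqxx => /eqP.
  by rewrite eq_sym oner_eq0.
have z2T (s : {set 'I_n}) : x \in s -> z2 s = 0.
  by move=> xs'; rewrite -(setD1K xs'); apply: (z2x _ _).1; rewrite setD11.
have [|||||b2 Qb2 z2b2] := IH z2; first exact: path_sorted sxs.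
- move=> s a u; case: (boolP (x \in s)) => [/z2T->|/z2N->]; rewrite mxE ?msupp0 //.
  by rewrite mem_msupp_psel => /andP[_ /Pz].
- move=> s a u i; case: (boolP (x \in s)) => [/z2T->|/z2N->]; rewrite mxE ?msupp0 //.
  rewrite mem_msupp_psel => /andP[/eqP ux uz] ui; move: (xz _ _ _ _ uz ui); rewrite inE.
  by case: eqP => // e; move: ui; rewrite e ux.
- move=> s; case: (boolP (x \in s)) => [xs'|/z2x[] //].
  rewrite (eq_kd (c' := fun=> 0)) ?kd0 // => w _ _.
  by rewrite z2T // in_setU1 xs' orbT.
- move=> s a h; case: (boolP (x \in s)) => [/z2T->|xs']; first by rewrite mxE mcoeff0.
  rewrite z2N // mxE mcoeff_psel mnm0E eqxx z0 // => w; rewrite inE.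
  by case/orP => [/eqP->|/h].
exists (fun s : {set 'I_n} => b1 s + if x \in s then 0 else b2 s).
  move=> s a u; rewrite /b1 mxE; case: ifP => _; last by rewrite mxE add0r => /Qb2.
  rewrite [X in _ + X]mxE addr0 mxE mcoeff_msupp mcoeff_pdiv -mcoeff_msupp => uz.
  (* A monomial of [b1] is (x u) / x with x u occurring in [z], and [x] is its largest variable
     because the list decreases. *)
  have -> : u = (U_(x) + u - U_(x))%MM by apply/mnmP => i; rewrite mnmBE mnmDE addKn.
  apply: PQ; first exact: Pz uz.
    by rewrite mnmDE mnm1E eqxx.
  move=> i /(xz _ _ _ _ uz); rewrite inE => /orP[/eqP->//|/ltx/ltnW//].
move=> s; rewrite kdD -(subrK (kd (x :: xs) b1 s) (z s)) addrC -/(z2 s); congr (_ + _).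
rewrite /= setU11 scaler0 addr0; case: ifP => [xs'|/negbT xs'].
  rewrite (eq_kd (c' := fun=> 0)) ?kd0 ?oppr0 ?z2T // => w _ _.
  by rewrite in_setU1 xs' orbT.
rewrite z2b2; apply: eq_kd => w wxs _; rewrite in_setU1 (negbTE xs') orbF.
by case: eqP => // e; rewrite e wxs in xxs.
Qed.

End Koszul.

(** * Graded Koszul chains and dimension shifting *)

Section Graded.
Context (K : fieldType) (n : nat).
Local Notation S := {mpoly K[n]}.
Local Notation chain r := ({set 'I_n} -> 'rV[S]_r).
Implicit Types (d z : int) (q : nat) (s t : {set 'I_n}).

(** Decreasing order, so that [koszul_acyclic] contracts with the last variable first. *)
Definition vars : seq 'I_n := rev (enum 'I_n).

Lemma sorted_vars : sorted (fun x y : 'I_n => y < x)%N vars.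
Proof.
rewrite rev_sorted; have := iota_ltn_sorted 0 n.
by rewrite -val_enum_ord sorted_map.
Qed.

Lemma uniq_vars : uniq vars.
Proof. by rewrite rev_uniq enum_uniq. Qed.

Lemma mem_vars i : i \in vars.
Proof. by rewrite mem_rev mem_enum. Qed.

(** The Koszul complex of the free module S^r resolves K^r, and constant terms on [set0] detect that
    quotient; this is [koszul_acyclic] with trivial [P] and [Q]. *)
Lemma kd_vars_exact r (z : chain r) :
  (forall s, kd vars z s = 0) -> (forall a, (z set0 0 a)@_0 = 0) ->
  exists b : chain r, forall s, z s = kd vars b s.
Proof.
move=> cz z0.
have [||||b _ zb] := @koszul_acyclic K n r (fun _ _ => True) (fun _ _ => True)
  vars z sorted_vars _ _ _ cz; last by exists b.
- by [].
- by [].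
- by move=> *; apply: mem_vars.
move=> s a h; suff -> : s = set0 by [].
by apply/setP => i; rewrite inE; apply/negbTE/h/mem_vars.
Qed.

Definition hcomp z (p : S) : S := psel (fun m => (mdeg m)%:Z == z) p.

Lemma hcompM z e (p q : S) : (forall m, m \in msupp q -> (mdeg m)%:Z = e) ->
  hcomp (z + e) (p * q) = hcomp z p * q.
Proof.
move=> hq; rewrite -{1}(subrK (hcomp z p) p) mulrDl /hcomp pselD.
rewrite eq_psel0 ?add0r.
  apply: psel_id => m /msuppM_le /allpairsP[[u v] /= [+ /hq vq ->]].
  by rewrite mem_msupp_psel mdegD PoszD vq => /andP[/eqP->].
move=> m /msuppM_le /allpairsP[[u v] /= [+ /hq vq ->]].
rewrite mcoeff_msupp mcoeffB mcoeff_psel mdegD PoszD vq (inj_eq (addIr _)).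
by case: (eqVneq (Posz _) z) => // _; rewrite subrr eqxx.
Qed.

(** Each wedge factor e_x has degree 1, whence the summand [q] in the internal degree. *)
Definition hchain r (dg : 'I_r -> int) q d (c : chain r) :=
  forall s a m, m \in msupp (c s 0 a) ->
    #|s| = q /\ (mdeg m)%:Z + dg a + q%:Z = d.

(** The projection onto bidegree (q, d). It commutes with [kd] and with graded matrices, so it makes
    lifts chosen without regard to degree homogeneous. *)
Definition ccomp r (dg : 'I_r -> int) q d (c : chain r) : chain r := fun s =>
  if #|s| == q then \row_a hcomp (d - q%:Z - dg a) (c s 0 a) else 0.

Lemma ccomp_hchain r dg q d (c : chain r) : hchain dg q d (ccomp dg q d c).
Proof.
move=> s a m; rewrite /ccomp; case: eqP => sq; rewrite mxE ?msupp0 //.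
by rewrite mem_msupp_psel => /andP[/eqP-> _]; split=> //; ring.
Qed.

Lemma ccomp_id r dg q d (c : chain r) s : hchain dg q d c -> ccomp dg q d c s = c s.
Proof.
move=> hc; rewrite /ccomp; case: eqP => sq; apply/rowP => a; rewrite !mxE.
  by apply: psel_id => m /hc[_ <-]; apply/eqP; ring.
apply/esym/eqP; rewrite -msupp_eq0; case E: (msupp _) => [//|m l].
by case: (hc s a m); rewrite ?E ?mem_head.
Qed.

Lemma eq_ccomp r dg q d (c c' : chain r) s : c s = c' s -> ccomp dg q d c s = ccomp dg q d c' s.
Proof. by rewrite /ccomp => ->. Qed.

Lemma ccomp0 r dg q d (c : chain r) s : c s = 0 -> ccomp dg q d c s = 0.
Proof.
rewrite /ccomp => ->; case: ifP => // _; apply/rowP => a.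
by rewrite !mxE /hcomp psel0.
Qed.

Definition gradedmx r r' (dg : 'I_r -> int) (dg' : 'I_r' -> int) (A : 'M[S]_(r, r')) :=
  forall a b m, m \in msupp (A a b) -> (mdeg m)%:Z = dg a - dg' b.

Lemma ccomp_mulmx r r' dg dg' (A : 'M[S]_(r, r')) q d (c : chain r) s :
  gradedmx dg dg' A ->
  ccomp dg q d c s *m A = ccomp dg' q d (fun t => c t *m A) s.
Proof.
move=> gA; rewrite /ccomp; case: eqP => _; last by rewrite mul0mx.
apply/rowP => b; rewrite !mxE /hcomp psel_sum; apply: eq_bigr => a _.
rewrite mxE -/(hcomp _ _) -/(hcomp _ _) -(hcompM _ _ (gA a b)); congr hcomp.
by ring.
Qed.

Lemma kd_ccomp r dg xs q d (c : chain r) s :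
  kd xs (ccomp dg q.+1 d c) s = ccomp dg q d (kd xs c) s.
Proof.
elim: xs => [|x xs IH] /=; first by rewrite ccomp0.
rewrite IH /ccomp; case: ifP => [_|/negbT xs'].
  case: eqP => _; rewrite ?oppr0 //.
  by apply/rowP => a; rewrite !mxE /hcomp pselN.
rewrite cardsU1 xs' add1n eqSS; case: eqP => _; last by rewrite scaler0 addr0.
apply/rowP => a; rewrite !mxE /hcomp pselD; congr (_ + _).
rewrite -/(hcomp _ _) -/(hcomp _ _) mulrC [in RHS]mulrC -(hcompM _ (e := 1)).
  by congr hcomp; rewrite intS; ring.
by move=> m; rewrite msuppX inE => /eqP->; rewrite mdeg1.
Qed.

(* Vanishing of the Koszul homology of the row space [im A] in homological
   degree [q] and internal degree [d], with chains lifted along [A]. *)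
Definition koszul_vanishes r r' (A : 'M[S]_(r, r')) dg q d :=
  forall g, hchain dg q d g -> (forall s, kd vars g s *m A = 0) ->
  exists h : chain r, forall s, (g s - kd vars h s) *m A = 0.

(* The same for the kernel of the map from the Koszul homology of [im A] to
   that of the ambient free module. *)
Definition koszul_vanishes_rel r r' (A : 'M[S]_(r, r')) dg q d :=
  forall g, hchain dg q d g -> (exists f : chain r', forall s, g s *m A = kd vars f s) ->
  exists h : chain r, forall s, (g s - kd vars h s) *m A = 0.

(** In positive homological degree the Koszul homology of the ambient free module is zero, so the
    kernel of the map into it is everything. *)
Lemma koszul_vanishes_relE r r' (A : 'M[S]_(r, r')) dg q d :
  koszul_vanishes A dg q.+1 d <-> koszul_vanishes_rel A dg q.+1 d.
Proof.
split=> h g hg gA; apply: h => //.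
  case: gA => f fg s; rewrite -kd_mulmx (eq_kd (c' := kd vars f)) ?kdK ?uniq_vars //.
have [|a|f fg] := @kd_vars_exact r' (fun s => g s *m A); last by exists f.
  by move=> s; rewrite kd_mulmx.
suff -> : g set0 = 0 by rewrite mul0mx mxE mcoeff0.
by rewrite -(ccomp_id _ hg) /ccomp cards0.
Qed.

Lemma chain_lift r r' (A : 'M[S]_(r, r')) (c : chain r') :
  (forall s, exists v, c s = v *m A) -> exists w : chain r, forall s, c s = w s *m A.
Proof.
by move=> h; exists (fun s => epsilon (inhabits 0) (fun v => c s = v *m A)) => s;
  apply: epsilon_spec (h s).
Qed.

(** The sequence 0 -> im B -> S^r2 -> im A -> 0 has a connecting map from H_{q+1}(im A) to H_q(im
    B). It is injective because H_{q+1}(S^r2) = 0, and its image is the kernel of the map to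
    H_q(S^r2). *)
Lemma koszul_shift r1 r2 r3 (B : 'M[S]_(r1, r2)) (A : 'M[S]_(r2, r3)) dg1 dg2 q d :
  gradedmx dg1 dg2 B ->
  (forall v : 'rV_r2, v *m A = 0 <-> exists w, v = w *m B) ->
  koszul_vanishes A dg2 q.+1 d <-> koszul_vanishes_rel B dg1 q d.
Proof.
move=> gB ex; have BA w : w *m B *m A = 0 := (ex _).2 (ex_intro _ w erefl).
split=> H g hg.
  (* The chain f' A is a cycle over im A, so f' minus a boundary lies in ker A = im B; writing it as
     y B gives g B as the boundary of y B. *)
  case=> f fg; pose f' := ccomp dg2 q.+1 d f.
  have f'E s : kd vars f' s = g s *m B.
    rewrite kd_ccomp (eq_ccomp _ _ _ (c' := fun t => g t *m B)) // -(ccomp_mulmx _ _ _ _ gB).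
    by rewrite ccomp_id.
  have [|s|h hE] := H f'; first exact: ccomp_hchain; first by rewrite f'E.
  have [y yE] := chain_lift (c := fun s => f' s - kd vars h s) (fun s => (ex _).1 (hE s)).
  exists y => s; rewrite mulmxBl -f'E -kd_mulmx.
  rewrite (eq_kd (c := fun t => y t *m B) (c' := fun t => f' t - kd vars h t)) => [|x _ _]; last exact/esym/yE.
  by rewrite kdB kdK ?uniq_vars // subr0 subrr.
move=> gA; have [w wE] := chain_lift (fun s => (ex _).1 (gA s)).
pose w' := ccomp dg1 q d w.
have w'E s : w' s *m B = kd vars g s.
  rewrite (ccomp_mulmx _ _ _ _ gB) (eq_ccomp _ _ _ (c' := kd vars g)) // -kd_ccomp.
  by apply: eq_kd => x _ _; rewrite ccomp_id.
have [||h hE] := H w'; first exact: ccomp_hchain; first by exists g => s; rewrite w'E.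
pose h' := ccomp dg1 q.+1 d h.
have h'E s : kd vars h' s *m B = kd vars g s.
  rewrite kd_ccomp (ccomp_mulmx _ _ _ _ gB) -w'E.
  rewrite (eq_ccomp _ _ _ (c' := fun s => w' s *m B)); last first.
    by apply/esym/eqP; rewrite -subr_eq0 -mulmxBl hE.
  by rewrite -(ccomp_mulmx _ _ _ _ gB) ccomp_id //; apply: ccomp_hchain.
(* The chain g - h' B is a cycle of positive degree over S^r2, hence a boundary, and A kills the
   correction h' B. *)
have [|a|f fE] := @kd_vars_exact r2 (fun s => g s - h' s *m B).
- by move=> s; rewrite kdB kd_mulmx h'E subrr.
- rewrite -(ccomp_id _ hg) /h' /ccomp cards0 /= mul0mx subrr.
  by rewrite mxE mcoeff0.
by exists f => s; rewrite -fE opprB addrC subrK BA.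
Qed.

End Graded.

(** * Graded Betti numbers as Koszul homology *)

Section Betti.
Context (K : fieldType) (n : nat).
Local Notation S := {mpoly K[n]}.
Local Notation chain r := ({set 'I_n} -> 'rV[S]_r).
Local Notation cst := (map_mx (mcoeff (0%MM : 'X_{1..n}))).
Local Notation const_chain u := (fun s : {set 'I_n} => if s == set0 then map_mx (@mpolyC n K) u else 0).

Definition concentrated r (dg : 'I_r -> int) d (u : 'rV[K]_r) :=
  forall a, u 0 a != 0 -> dg a = d.

Lemma hchain0N r dg d (g : chain r) s : hchain dg 0 d g -> s != set0 -> g s = 0.
Proof. by move=> /ccomp_id <- s0; rewrite /ccomp cards_eq0 (negbTE s0). Qed.

Lemma const_chain_hchain r dg d (u : 'rV[K]_r) :
  concentrated dg d u -> hchain dg 0 d (const_chain u).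
Proof.
move=> hu s a m; case: eqP => [->|_]; last by rewrite mxE msupp0.
rewrite mxE msuppC; case: eqP => // /eqP ua; rewrite inE => /eqP->.
by rewrite cards0 mdeg0 add0r addr0 hu.
Qed.

Lemma cst_concentrated r dg d (g : chain r) :
  hchain dg 0 d g -> concentrated dg d (cst (g set0)).
Proof.
move=> hg a; rewrite mxE -mcoeff_msupp => /hg[_].
by rewrite mdeg0 add0r addr0.
Qed.

Lemma cst_mpolyC r (u : 'rV[K]_r) : cst (map_mx (@mpolyC n K) u) = u.
Proof. by apply/rowP => a; rewrite !mxE /= mpolyCK. Qed.

Lemma cst_kd r (h : chain r) s : cst (kd (vars n) h s) = 0.
Proof.
apply/rowP => a; rewrite !mxE; apply: mcoeff_kd => x _ _.
by rewrite mcoeffXM0 ?mnm0E.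
Qed.

(** In homological degree 0 the boundaries are the vectors without constant terms, so bounding
    modulo ker A = im B means that the constant part lies in the row space of [cst B]. [Pu] and [Pg]
    are matching side conditions. *)
Lemma cst_boundary r1 r2 r3 (B : 'M[S]_(r1, r2)) (A : 'M[S]_(r2, r3)) dg d
    (Pu : 'rV[K]_r2 -> Prop) (Pg : chain r2 -> Prop) :
  (forall v : 'rV_r2, v *m A = 0 <-> exists w, v = w *m B) ->
  (forall g, hchain dg 0 d g -> Pg g -> Pu (cst (g set0))) ->
  (forall u, concentrated dg d u -> Pu u -> Pg (const_chain u)) ->
  (forall u, concentrated dg d u -> Pu u -> exists w, u = w *m cst B) <->
  (forall g, hchain dg 0 d g -> Pg g ->
     exists h : chain r2, forall s, (g s - kd (vars n) h s) *m A = 0).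
Proof.
move=> ex gu ug; split=> H.
  move=> g hg Pgg; have [w uw] := H _ (cst_concentrated hg) (gu g hg Pgg).
  pose y := map_mx (@mpolyC n K) w.
  (* Subtracting y B at [set0] cancels the constant part, so the rest bounds. *)
  pose z : chain r2 := fun s => g s - if s == set0 then y *m B else 0.
  have zN s : s != set0 -> z s = 0.
    by move=> s0; rewrite /z (hchain0N hg) // (negbTE s0) subrr.
  have [s|a|h zE] := kd_vars_exact (z := z).
  - rewrite (eq_kd (c' := fun=> 0)) ?kd0 // => x _ _; apply: zN.
    by apply/set0Pn; exists x; rewrite setU11.
  - rewrite /z /y eqxx !mxE; move/rowP/(_ a): uw; rewrite !mxE mcoeffB => ->.
    rewrite raddf_sum -sumrB big1 // => i _ /=.
    by rewrite rmorphM /= !mxE mpolyCK subrr.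
  exists h => s; rewrite -zE /z opprB addrC subrK; case: eqP => _; last by rewrite mul0mx.
  by apply/ex; exists y.
move=> u hu Puu; have [|h hE] := H _ (const_chain_hchain hu); first exact: ug.
have [w /(congr1 (fun v => cst v))] := (ex _).1 (hE set0).
by rewrite map_mxB cst_kd subr0 eqxx cst_mpolyC map_mxM; exists (cst w).
Qed.

Context (I : S -> Prop) (F : gfree_resolution I).

Definition tensor_cycle i : 'rV[K]_(gfr_rank F i) -> Prop :=
  match i with 0 => fun=> True | i'.+1 => fun u => u *m tensor_dif F i' = 0 end.

Lemma sub_tensor_comp i d (u : 'rV_(gfr_rank F i)) :
  (u <= tensor_comp F i d)%MS <-> concentrated (gfr_deg F i) d u.
Proof.
split=> [/submxP[w ->] a|hu].
  rewrite /tensor_comp mul_mx_diag !mxE; case: (eqVneq (gfr_deg F i a) d) => // _.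
  by rewrite mulr0n mulr0 eqxx.
rewrite -[u](_ : u *m tensor_comp F i d = u) ?submxMl //.
rewrite /tensor_comp mul_mx_diag; apply/rowP => a; rewrite !mxE.
case: (eqVneq (gfr_deg F i a) d) => [_|/eqP]; first by rewrite mulr1n mulr1.
by case: (eqVneq (u 0 a) 0) => [->|/hu//]; rewrite mul0r.
Qed.

Lemma gfr_difK i : gfr_dif F i.+1 *m gfr_dif F i = 0.
Proof.
apply/row_matrixP => a; rewrite row_mul row0.
by apply/gfr_dif_exact; exists (row a 1%:M); rewrite -row_mul mul1mx.
Qed.

Lemma tensor_dif_graded i a b : tensor_dif F i a b != 0 -> gfr_deg F i.+1 a = gfr_deg F i b.
Proof.
rewrite mxE -mcoeff_msupp => /gfr_dif_homog /esym/eqP.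
by rewrite mdeg0 subr_eq0 => /eqP.
Qed.

Lemma concentrated_tensor_dif i d w :
  concentrated (gfr_deg F i.+1) d w -> concentrated (gfr_deg F i) d (w *m tensor_dif F i).
Proof.
move=> hw b; rewrite mxE; apply: contraNeq => db.
rewrite big1 // => a _; apply/eqP; apply: contraNT db.
by rewrite mulf_eq0 negb_or => /andP[/hw <- /tensor_dif_graded ->].
Qed.

(** [w] may be inhomogeneous: [tensor_dif] links only basis vectors of equal degree, so the degree
    [d] part of [w] already maps to [u]. *)
Lemma betti_eq0 i d : betti F i d = 0%N <->
  forall u, concentrated (gfr_deg F i) d u -> tensor_cycle u ->
  exists w, u = w *m tensor_dif F i.
Proof.
have cycE (u : 'rV_(gfr_rank F i)) : (u <= tor_cycles F i d)%MS <->
    concentrated (gfr_deg F i) d u /\ tensor_cycle u.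
  rewrite /tor_cycles sub_capmx; split=> [/andP[/sub_tensor_comp hu ku]|[/sub_tensor_comp-> /=]].
    by split=> //; case: (i) u hu ku => [|j] u hu //= /sub_kermxP.
  by case: (i) u => [|j] u /= h; rewrite ?submx1 //; apply/sub_kermxP.
(* [betti] is a truncated difference of ranks; as boundaries are cycles, it vanishes exactly when
   the two spaces agree. *)
have sub : (tor_boundaries F i d <= tor_cycles F i d)%MS.
  apply/row_subP => a; apply/cycE; rewrite row_mul; split.
    by apply/concentrated_tensor_dif/sub_tensor_comp/row_sub.
  case: (i) a => [|j] a //=; rewrite -mulmxA -map_mxM gfr_difK.
  by rewrite map_mx0 mulmx0.
have -> : betti F i d = 0%N <-> (tor_cycles F i d <= tor_boundaries F i d)%MS.
  rewrite /betti -(mxrank_leqif_sup sub).2 eqn_leq (mxrankS sub) /=.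
  by split=> [/eqP|/eqP].
split=> [cb u hu cu|H].
  have /submxP[w ->] := submx_trans ((cycE u).2 (conj hu cu)) cb.
  by exists (w *m tensor_comp F i.+1 d); rewrite mulmxA.
apply/row_subP => a; have [hu cu] := (cycE _).1 (row_sub a (tor_cycles F i d)).
have [w e] := H _ hu cu; set u := row a _ in hu cu e *.
have -> : u = w *m tor_boundaries F i d; last exact: submxMl.
have cE c : (w *m tensor_comp F i.+1 d) 0 c = w 0 c * (gfr_deg F i.+1 c == d)%:R.
  by rewrite /tensor_comp mul_mx_diag !mxE.
apply/rowP => b; rewrite /tor_boundaries mulmxA e [LHS]mxE [RHS]mxE.
have := hu b; rewrite e mxE.
case: (eqVneq (gfr_deg F i b) d) => [bd _|bd hb].
  apply: eq_bigr => c _; rewrite cE.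
  case: (eqVneq (tensor_dif F i c b) 0) => [->|/tensor_dif_graded ->]; first by rewrite !mulr0.
  by rewrite bd eqxx mulr1n mulr1.
have -> : \sum_j w 0 j * tensor_dif F i j b = 0 by apply/eqP; apply: contraNT bd => /hb->.
rewrite big1 // => c _; rewrite cE.
case: (eqVneq (tensor_dif F i c b) 0) => [->|/tensor_dif_graded ->]; first by rewrite !mulr0.
by rewrite (negbTE bd) mulr0n mulr0 mul0r.
Qed.

(** An element of F_i is a Koszul boundary exactly when its constant terms vanish, which turns
    tensor cycles into the relative condition. *)
Lemma betti_dif i d :
  betti F i.+1 d = 0%N <-> koszul_vanishes_rel (gfr_dif F i) (gfr_deg F i.+1) 0 d.
Proof.
apply: (iff_trans (betti_eq0 _ _)); apply: cst_boundary.
- exact: gfr_dif_exact.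
- move=> g hg [f fE] /=; rewrite -[tensor_dif F i]/(cst (gfr_dif F i)) -map_mxM fE.
  exact: cst_kd.
move=> u hu; rewrite /= -[tensor_dif F i]/(cst (gfr_dif F i)) => u0.
apply: kd_vars_exact.
  move=> s; rewrite (eq_kd (c' := fun=> 0)) ?kd0 // => x _ _.
  rewrite ifN ?mul0mx //; apply/set0Pn; exists x; exact: setU11.
move=> a; rewrite eqxx.
transitivity (cst (map_mx (@mpolyC n K) u *m gfr_dif F i) 0 a); first by rewrite [RHS]mxE.
by rewrite map_mxM cst_mpolyC u0 mxE.
Qed.

Lemma betti_aug d :
  betti F 0 d = 0%N <-> koszul_vanishes (gfr_aug F) (@gfr_deg _ _ _ F 0) 0 d.
Proof.
apply: (iff_trans (betti_eq0 _ _)); apply: cst_boundary => //.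
  exact: gfr_aug_exact.
move=> u hu _ s; rewrite (eq_kd (c' := fun=> 0)) ?kd0 ?mul0mx // => x _ _.
rewrite ifN //; apply/set0Pn; exists x; exact: setU11.
Qed.

Lemma betti_koszul i d :
  betti F i d = 0%N <-> koszul_vanishes (gfr_aug F) (@gfr_deg _ _ _ F 0) i d.
Proof.
case: i => [|i]; first exact: betti_aug.
have dif k : gradedmx (gfr_deg F k.+1) (gfr_deg F k) (gfr_dif F k) by apply: gfr_dif_homog.
rewrite (koszul_shift _ _ (dif 0%N) (@gfr_aug_exact _ _ _ F)) betti_dif.
(* Each round trades one Koszul degree for one step along the resolution, down to degree 0, the case
   of [betti_dif]. *)
suff key j k : koszul_vanishes_rel (gfr_dif F (k + j)) (gfr_deg F (k + j).+1) 0 d <->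
  koszul_vanishes_rel (gfr_dif F k) (gfr_deg F k.+1) j d by apply: (key i 0%N).
elim: j k => [|j IH] k; first by rewrite addn0.
rewrite -koszul_vanishes_relE (koszul_shift _ _ (dif k.+1) (@gfr_dif_exact _ _ _ F k)).
by rewrite -addSnnS.
Qed.

End Betti.

(** * Monomial ideals, minimal generators and stability *)

Section MonomialIdeals.
Context (K : fieldType) (n : nat).
Local Notation S := {mpoly K[n]}.
Implicit Types (u v m w : 'X_{1..n}) (A : 'X_{1..n} -> Prop).

Lemma ideal_gen_sub (G G' : S -> Prop) p :
  (forall q, G q -> G' q) -> ideal_gen G p -> ideal_gen G' p.
Proof. by move=> h [s hs ->]; exists s => // c /hs/h. Qed.

Lemma ideal_gen_sum (T : eqType) (r : seq T) (f : T -> S) (G : S -> Prop) :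
  (forall i, i \in r -> ideal_gen G (f i)) -> ideal_gen G (\sum_(i <- r) f i).
Proof.
elim: r => [|i r IH] h; first by exists [::]; rewrite ?big_nil.
have [s hs E] := IH (fun j jr => h j (mem_behead (s := i :: r) jr)).
have [s' hs' E'] := h i (mem_head _ _).
exists (s' ++ s); last by rewrite big_cons big_cat /= E E'.
by move=> c; rewrite mem_cat => /orP[/hs'|/hs].
Qed.

Lemma ideal_gen_mull (G : S -> Prop) q p : G p -> ideal_gen G (q * p).
Proof.
by move=> Gp; exists [:: (q, p)] => [c|]; rewrite ?big_seq1 // inE => /eqP->.
Qed.

Lemma mnm_leB1 u v i : (u <= v)%MM -> (u i < v i)%N -> (u <= v - U_(i))%MM.
Proof.
move=> /mnm_lepP uv ui; apply/mnm_lepP => j; rewrite mnmBE mnm1E.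
by case: eqP => [<-|_]; rewrite ?subn0 ?uv // subn1 -ltnS prednK // (leq_ltn_trans _ ui).
Qed.

Lemma mnm_ltP u v : (u <= v)%MM -> u != v -> exists i, (u i < v i)%N.
Proof.
move=> /mnm_lepP uv /eqP ne; apply: NNPP => h; apply: ne; apply/mnmP => i.
apply/eqP; rewrite eqn_leq uv leqNgt; apply/negP => lt; apply: h; by exists i.
Qed.

Lemma mdeg_le u v : (u <= v)%MM -> (mdeg u <= mdeg v)%N.
Proof. by move/mnm_lepP => uv; rewrite !mdegE; apply: leq_sum => i _; apply: uv. Qed.

Lemma mnm_subK u i : (0 < u i)%N -> (u - U_(i) + U_(i))%MM = u.
Proof.
move=> ui; apply: submK; by rewrite lep1mP -lt0n.
Qed.

Lemma mdeg_subU u i : (0 < u i)%N -> mdeg u = (mdeg (u - U_(i))%MM).+1.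
Proof. by move=> ui; rewrite -{1}(mnm_subK ui) mdegD mdeg1 addn1. Qed.

Lemma ideal_gen_monoP A (p : S) :
  ideal_gen (fun q => exists2 m, A m & q = 'X_[m]) p <->
  forall u, u \in msupp p -> exists2 m, A m & (m <= u)%MM.
Proof.
split=> [[s hs ->] u|h].
  elim: s hs => [|c s IH] hs; first by rewrite big_nil msupp0.
  rewrite big_cons => /msuppD_le; rewrite mem_cat => /orP[|]; last first.
    by apply: IH => c' c's; apply: hs; rewrite inE c's orbT.
  move=> /msuppM_le/allpairsP[[u1 u2] /= [_ u2c ->]].
  have [m Am e] := hs c (mem_head _ _); exists m => //.
  by move: u2c; rewrite e msuppX inE => /eqP ->; apply: lem_addl.
rewrite (mpolyE p); apply: ideal_gen_sum => u /h[m Am mu].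
rewrite -(submK mu) mpolyXD scalerAl; apply: ideal_gen_mull; by exists m.
Qed.

Context (I : S -> Prop) (monoI : monomial_ideal I).

Lemma mem_monoP p : I p <-> forall u, u \in msupp p -> I 'X_[u].
Proof.
case: monoI => A IA; split=> [/IA/ideal_gen_monoP h u /h hu|h].
  by apply/IA/ideal_gen_monoP => v; rewrite msuppX inE => /eqP->.
apply/IA/ideal_gen_monoP => u /h /IA/ideal_gen_monoP; apply.
by rewrite msuppX inE.
Qed.

Lemma mono_gensP A :
  mono_gens I A <-> forall u, I 'X_[u] <-> exists2 m, A m & (m <= u)%MM.
Proof.
split=> IA.
  move=> u; split=> [/IA/ideal_gen_monoP|h]; first by apply; rewrite msuppX inE.
  by apply/IA/ideal_gen_monoP => v; rewrite msuppX inE => /eqP->.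
move=> p; split=> [/mem_monoP h|/ideal_gen_monoP h].
  by apply/ideal_gen_monoP => u /h/IA.
by apply/mem_monoP => u /h/IA.
Qed.

Lemma mem_mono_le u v : I 'X_[u] -> (u <= v)%MM -> I 'X_[v].
Proof.
case: monoI => A /mono_gensP IA /IA[m Am mu] uv; apply/IA.
by exists m => //; apply: lepm_trans uv.
Qed.

(** Minimality under divisibility; quotients by a single variable suffice as [I] is closed under
    multiples. *)
Definition min_mono m := I 'X_[m] /\ forall i, (0 < m i)%N -> ~ I 'X_[(m - U_(i))%MM].

Lemma min_mono_le u : I 'X_[u] -> exists2 m, min_mono m & (m <= u)%MM.
Proof.
have [N] := ubnP (mdeg u); elim: N u => // N IH u; rewrite ltnS => uN Iu.
case: (classic (exists2 i, (0 < u i)%N & I 'X_[(u - U_(i))%MM])) => [[i ui Iui]|h].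
  have [|m mm mu] := IH (u - U_(i))%MM _ Iui; first by rewrite -(mdeg_subU ui).
  by exists m => //; apply: lepm_trans mu _; apply: lem_subr.
exists u; last exact: lepm_refl.
by split=> // i ui Iui; apply: h; exists i.
Qed.

Lemma min_mono_gensP m : mingens I m <-> min_mono m.
Proof.
split=> [[A [/mono_gensP IA minA] Am]|mm].
  split=> [|i mi /IA[a Aa am]]; first by apply/IA; exists m; rewrite ?lepm_refl.
  have ne : a <> m.
    by move=> e; move/mnm_lepP/(_ i): am; rewrite e mnmBE mnm1E eqxx subn1; case: (m i) mi => // j _; rewrite ltnn.
  suff h : mono_gens I (fun b => A b /\ b <> m).
    have sub b : A b /\ b <> m -> A b by case.
    by case: (minA _ sub h _ Am).
  apply/mono_gensP => u; split=> [/IA[b Ab bu]|[b [Ab _] bu]]; last by apply/IA; exists b.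
  case: (b =P m) => [e|ne']; last by exists b.
  exists a => //; apply: lepm_trans am _; apply: lepm_trans (lem_subr _ _) _.
  by rewrite -e.
exists min_mono => //; split.
  apply/mono_gensP => u; split=> [/min_mono_le //|[b [Ib _] bu]].
  exact: mem_mono_le bu.
move=> B BM /mono_gensP IB v [Iv vmin]; have [b Bb bv] := (IB v).1 Iv.
case: (eqVneq b v) => [<- //|/(mnm_ltP bv)[i bvi]].
case: (vmin i); first exact: leq_ltn_trans bvi.
by apply/IB; exists b => //; apply: mnm_leB1.
Qed.

Lemma trunc_geP e u : trunc_ge I e 'X_[u] <-> I 'X_[u] /\ e <= (mdeg u)%:Z.
Proof.
split=> [h|[Iu eu]].
  have /ideal_gen_monoP/(_ u) [|m [Im em] mu] :
    ideal_gen (fun q : S => exists2 m, I 'X_[m] /\ e <= (mdeg m)%:Z & q = 'X_[m]) 'X_[u].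
  - by apply: ideal_gen_sub h => q [m [Im em ->]]; exists m.
  - by rewrite msuppX inE.
  split; first exact: mem_mono_le mu.
  by apply: le_trans em _; rewrite lez_nat mdeg_le.
by rewrite -['X_[u]]mul1r; apply: ideal_gen_mull; exists u.
Qed.

Lemma max_varP u (k : 'I_n) :
  max_var u = k.+1 <-> (0 < u k)%N /\ (forall i : 'I_n, 0 < u i -> i <= k)%N.
Proof.
rewrite /max_var; split=> [e|[uk h]].
  have h (i : 'I_n) : (0 < u i)%N -> (i <= k)%N.
    by move=> ui; rewrite -ltnS -e; exact: (@leq_bigmax_cond _ (fun i : 'I_n => 0 < u i)%N (fun i : 'I_n => i.+1)).
  split=> //; have [j uj|u0] := pickP (fun i => 0 < u i)%N; last first.
    by move: e; rewrite big_pred0.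
  have [|j0 uj0 ej] := @eq_bigmax_cond _ [pred i : 'I_n | 0 < u i]%N (fun i : 'I_n => i.+1).
    by apply/card_gt0P; exists j.
  have -> // : k = j0 by apply/val_inj/succn_inj; rewrite -e -ej.
apply/eqP; rewrite eqn_leq; apply/andP; split; first by apply/bigmax_leqP => i /h.
exact: (@leq_bigmax_cond _ (fun i : 'I_n => 0 < u i)%N (fun i : 'I_n => i.+1)).
Qed.

Lemma max_var_gt u (l : 'I_n) : (0 < u l)%N -> exists2 k : 'I_n, max_var u = k.+1 & (l <= k)%N.
Proof.
move=> ul; case: (@arg_maxnP _ l (fun i : 'I_n => 0 < u i)%N val ul) => k uk h.
exists k; last exact: h.
by apply/max_varP; split.
Qed.

(** Exchanging x_k for x_j keeps the degree, so the truncation only constrains [u]. *)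
Lemma stable_truncP e : stable (trunc_ge I e) <->
  forall u (j k : 'I_n), I 'X_[u] -> e <= (mdeg u)%:Z -> max_var u = k.+1 ->
    (j < k)%N -> I 'X_[(u - U_(k) + U_(j))%MM].
Proof.
have sw u (j k : 'I_n) : max_var u = k.+1 -> (U_(j) + u - U_(k) = u - U_(k) + U_(j))%MM.
  move=> /max_varP[uk _]; rewrite -{1}(mnm_subK uk).
  by apply/mnmP => i; rewrite !(mnmDE, mnmBE) !mnm1E; lia.
split=> st u j k.
  move=> Iu eu uk jk; have /trunc_geP[] := st u j k ((trunc_geP _ _).2 (conj Iu eu)) uk jk.
  by rewrite (sw u j k uk).
move=> /trunc_geP[Iu eu] uk jk; rewrite sw //; apply/trunc_geP; split; first exact: st.
by rewrite mdegD mdeg1 addn1 -mdeg_subU //; case/max_varP: uk.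
Qed.

End MonomialIdeals.

(** * Maxima of bounded sets of integers *)

Section IntMax.
Implicit Types (P : int -> Prop).

Lemma maxz_is_max P z B : P z -> (forall y, P y -> y <= B) -> is_maxz P (maxz P).
Proof.
move=> Pz PB; apply: epsilon_spec.
have [N] := ubnP `|B - z|%N; elim: N z Pz => // N IH z Pz; rewrite ltnS => hN.
case: (classic (exists2 y, P y & z < y)) => [[y Py zy]|h].
  by apply: (IH y Py); have := PB _ Py; lia.
by exists z; split=> // y Py; rewrite leNgt; apply/negP => zy; apply: h; exists y.
Qed.

End IntMax.

(** * Bounds on the regularity from generators, socles and stability *)

Section Regularity.
Context (K : fieldType) (n : nat).
Local Notation S := {mpoly K[n]}.
Local Notation chain r := ({set 'I_n} -> 'rV[S]_r).
Local Notation vars := (vars n).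
Context (I : S -> Prop) (monoI : monomial_ideal I) (F : gfree_resolution I).
Implicit Types (u v m w : 'X_{1..n}) (d e : int).

Local Notation dg1 := (fun _ : 'I_1 => 0 : int).

Lemma gradedmx_aug : gradedmx (@gfr_deg _ _ _ F 0) dg1 (gfr_aug F).
Proof. by move=> a b m; rewrite (ord1 b) subr0; apply: gfr_aug_homog. Qed.

Lemma aug_im (v : 'rV[S]_1) : I (v 0 0) <-> exists y, v = y *m gfr_aug F.
Proof.
split=> [/(gfr_aug_im F)[w vw]|[w ->]]; last by apply/(gfr_aug_im F); exists w.
by exists w; apply/rowP => i; rewrite (ord1 i).
Qed.

(** [gfr_aug] maps lifted chains onto the chains with values in [I], so the resolution disappears
    from the condition. *)
Lemma betti_ideal i d : betti F i d = 0%N <->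
  forall z : chain 1, hchain dg1 i d z -> (forall s, I (z s 0 0)) ->
    (forall s, kd vars z s = 0) ->
  exists2 b : chain 1, (forall s, I (b s 0 0)) & forall s, z s = kd vars b s.
Proof.
rewrite betti_koszul; split=> H.
  move=> z hz Iz cz.
  have [g gE] := chain_lift (fun s => (aug_im _).1 (Iz s)).
  have g'E s : ccomp (@gfr_deg _ _ _ F 0) i d g s *m gfr_aug F = z s.
    rewrite (ccomp_mulmx _ _ _ _ gradedmx_aug) (eq_ccomp _ _ _ (c' := z)) ?ccomp_id //.
  have [|h hE] := H _ (@ccomp_hchain _ _ _ _ i d g).
    move=> s; rewrite -kd_mulmx -[RHS](cz s); apply: eq_kd => x _ _; exact: g'E.
  exists (fun s => h s *m gfr_aug F) => s; first by apply/aug_im; exists (h s).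
  by apply/eqP; rewrite kd_mulmx -g'E -subr_eq0 -mulmxBl hE.
move=> g hg gA; have [|||b Ib bE] := H (fun s => g s *m gfr_aug F).
- move=> s a m; rewrite -(ccomp_id s hg) (ccomp_mulmx _ _ _ _ gradedmx_aug).
  exact: ccomp_hchain.
- by move=> s; apply/aug_im; exists (g s).
- by move=> s; rewrite kd_mulmx.
have [h hE] := chain_lift (fun s => (aug_im _).1 (Ib s)).
exists h => s; rewrite mulmxBl bE -kd_mulmx; apply/eqP; rewrite subr_eq0; apply/eqP.
by apply: eq_kd.
Qed.

Lemma betti_gt_n i d : (n < i)%N -> betti F i d = 0%N.
Proof.
move=> ni; apply/betti_ideal => z hz _ _; exists (fun=> 0) => s.
  by apply/(mem_monoP monoI) => u; rewrite mxE msupp0.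
rewrite kd0 // -(ccomp_id s hz) /ccomp ifN // ltn_eqF //.
by apply: leq_ltn_trans ni; rewrite -[X in (_ <= X)%N]card_ord max_card.
Qed.

Lemma betti_deg i d : betti F i d <> 0%N -> exists a, gfr_deg F i a = d.
Proof.
move=> h; apply: NNPP => na; apply: h; apply/betti_eq0 => u hu _; exists 0.
rewrite mul0mx; apply/rowP => a; rewrite mxE; apply/eqP; apply: contra_notT na.
by move=> /hu; exists a.
Qed.

(** [F] may be infinitely long, but only i <= n contributes, and there [d] is the degree of one of
    finitely many basis vectors. *)
Lemma betti_bounded :
  exists B : int, forall i d, betti F i d <> 0%N -> d - i%:Z <= B.
Proof.
pose B := (\max_(i < n.+1) \max_(a < gfr_rank F i) `|gfr_deg F i a|)%N.
exists B%:Z => i d h; have [a ad] := betti_deg h.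
have iN : (i < n.+1)%N by rewrite ltnS leqNgt; apply/negP => /betti_gt_n/h.
have : (`|gfr_deg F i a| <= B)%N.
  have h1 := @leq_bigmax_cond _ xpredT (fun i : 'I_n.+1 =>
    \max_(a < gfr_rank F i) `|gfr_deg F i a|)%N (Ordinal iN) isT.
  have h2 := @leq_bigmax_cond _ xpredT (fun a => `|gfr_deg F i a|%N) a isT.
  exact: leq_trans h2 h1.
rewrite ad; lia.
Qed.

Lemma reg_ge i d : betti F i d <> 0%N -> d - i%:Z <= reg F.
Proof.
move=> h; have [B hB] := betti_bounded.
have [|y [i' [j [h' ->]]]|_] := @maxz_is_max
  (fun y => exists i j, betti F i j <> 0%N /\ y = j - i%:Z) (d - i%:Z) B.
- by exists i, d.
- exact: hB.
by apply; exists i, d.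
Qed.

(** Such an [m] is not x_i times a monomial of [I], so it survives in I / (x_1, ..., x_n) I. *)
Lemma min_mono_betti m : min_mono I m -> betti F 0 (mdeg m) <> 0%N.
Proof.
move=> [Im mmin] /betti_ideal/(_ (fun s => if s == set0 then const_mx 'X_[m] else 0)).
case=> [s a u|s|s|b Ib].
- case: eqP => [->|_]; rewrite mxE ?msupp0 // msuppX inE => /eqP->.
  by rewrite cards0 !addr0.
- case: eqP => _; rewrite mxE //; apply/(mem_monoP monoI) => u.
  by rewrite msupp0.
- rewrite (eq_kd (c' := fun=> 0)) ?kd0 // => x _ _.
  rewrite ifN //; apply/set0Pn; exists x; exact: setU11.
move/(_ set0); rewrite eqxx => /rowP/(_ 0); rewrite mxE => /mpolyP/(_ m).
rewrite mcoeffX eqxx mcoeff_kd => [/eqP|x _ _]; first by rewrite oner_eq0.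
have [m0|mx] := posnP (m x); first by rewrite mcoeffXM0.
rewrite mcoeffXM_lt //; apply: memN_msupp_eq0; apply/negP => mb.
by apply: (mmin x mx); apply: (mem_monoP monoI _).1 mb.
Qed.

(* For a socle monomial [w] of [K[x_1, ..., x_k]/I], the boundary of
   [w e_1 /\ ... /\ e_k] is a cycle over [I] which bounds only over [S]. *)
Lemma socle_betti w (k : 'I_n) :
  (forall i : 'I_n, 0 < w i -> i <= k)%N -> ~ I 'X_[w] ->
  (forall i : 'I_n, (i <= k)%N -> I 'X_[(U_(i) + w)%MM]) ->
  betti F k (mdeg w + k.+1)%:Z <> 0%N.
Proof.
(* Ordinals start at 0: [T] has k + 1 elements, and the boundary of [W] sits in homological degree
   [k]. *)
move=> wk nIw sw; pose T := [set i : 'I_n | i <= k]%N.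
pose W : chain 1 := fun s => if s == T then const_mx 'X_[w] else 0.
have hW : hchain dg1 k.+1 (mdeg w + k.+1)%:Z W.
  move=> s a u; rewrite /W; case: eqP => [->|_]; rewrite mxE ?msupp0 //.
  rewrite msuppX inE => /eqP->; split; last by rewrite addr0 PoszD.
  rewrite -sum1_card (eq_bigl (fun i : 'I_n => i < k.+1)%N) => [|i]; last by rewrite inE.
  by rewrite (big_ord_narrow (ltn_ord k)) sum1_card card_ord.
move/betti_ideal/(_ (kd vars W)); case=> [s a u|s|s|b Ib bE].
- rewrite (eq_kd (c' := ccomp dg1 k.+1 (mdeg w + k.+1)%:Z W)); last first.
    by move=> x _ _; rewrite ccomp_id.
  by rewrite kd_ccomp => /ccomp_hchain.
- apply/(mem_monoP monoI) => u; rewrite mcoeff_msupp => /eqP nz; apply: NNPP => nIu.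
  apply: nz; apply: mcoeff_kd => x _ xs; rewrite /W; case: eqP => [e|_]; rewrite mxE.
    rewrite -mpolyXD mcoeffX; case: eqP => // e'; case: nIu; rewrite -e'.
    by apply: sw; move/setP/(_ x): e; rewrite !inE eqxx.
  by rewrite mulr0 mcoeff0.
- by rewrite kdK ?uniq_vars.
have kT : k \in T by rewrite inE.
(* The chain W - b is a cycle. In its boundary at [T :\ k], the coefficient of x_k w comes from [T]
   alone, since no variable outside [T] divides x_k w; hence [w] occurs in [b T]. *)
have [|||y _ yt yk|j] := @mcoeff_kd1 _ _ _ vars (fun s => W s - b s) k (T :\ k) 0 (U_(k) + w)%MM.
- exact: mem_vars.
- by rewrite setD11.
- exact: uniq_vars.
- apply: mcoeffXM0; rewrite mnmDE mnm1E eq_sym (negbTE yk) add0n.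
  apply/eqP; rewrite eqn0Ngt; apply: contra yt => /wk.
  by rewrite !inE yk.
rewrite kdB bE subrr mxE mcoeff0 setD1K // mcoeffXM /W eqxx => /eqP.
rewrite eq_sym mulf_eq0 signr_eq0 /= !mxE mcoeffB mcoeffX eqxx subr_eq0 => /eqP e.
apply: nIw; apply: (mem_monoP monoI _).1 (Ib T) _ _.
by rewrite mcoeff_msupp -e oner_eq0.
Qed.

Hypothesis I_neq0 : exists2 p, I p & p != 0.

Lemma exists_mono : exists u, I 'X_[u].
Proof.
case: I_neq0 => p Ip p0; exists (mlead p).
by apply: (mem_monoP monoI _).1 Ip _ _; apply: mlead_supp.
Qed.

(** Generator degrees are bounded because each yields a nonzero Betti number in homological degree
    0. *)
Lemma ideal_degP : is_maxz (fun d => exists2 m, mingens I m & d = (mdeg m)%:Z) (ideal_deg I).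
Proof.
have [u /min_mono_le[m mm _]] := exists_mono.
have [B hB] := betti_bounded.
apply: (maxz_is_max (z := (mdeg m)%:Z) (B := B)).
  by exists m => //; apply/min_mono_gensP.
move=> y [m' /(min_mono_gensP monoI) mm' ->].
by have := hB _ _ (min_mono_betti mm'); rewrite subr0.
Qed.

Lemma ideal_deg_le_reg : ideal_deg I <= reg F.
Proof.
have [[m /(min_mono_gensP monoI) mm ->] _] := ideal_degP.
by have := reg_ge (min_mono_betti mm); rewrite subr0.
Qed.

Lemma regP : exists i d, betti F i d <> 0%N /\ reg F = d - i%:Z.
Proof.
have [u /min_mono_le[m /min_mono_betti mm _]] := exists_mono.
have [B hB] := betti_bounded.
have [] // := @maxz_is_max (fun y => exists i j, betti F i j <> 0%N /\ y = j - i%:Z)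
  ((mdeg m)%:Z - 0%N%:Z) B.
  by exists 0%N, (mdeg m)%:Z.
by move=> y [i [j [h ->]]]; apply: hB.
Qed.

(** As deg u > e >= deg I, [u] is not a minimal generator, so some u / x_i lies in [I] in degree at
    least [e]; for i <> k, stability exchanges its last variable x_k for x_i. *)
Lemma stable_max_var_sub e u (k : 'I_n) :
  ideal_deg I <= e -> stable (trunc_ge I e) -> I 'X_[u] -> e < (mdeg u)%:Z ->
  max_var u = k.+1 -> I 'X_[(u - U_(k))%MM].
Proof.
move=> le_e /(stable_truncP monoI) st Iu eu uk.
have [uk0 uk1] := (max_varP _ _).1 uk.
have [m mm mu] := min_mono_le Iu.
have [i mi] : exists i, (m i < u i)%N.
  apply: mnm_ltP => //; apply: contraTneq eu => <-; rewrite -leNgt.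
  apply: le_trans le_e; apply: ideal_degP.2; exists m => //.
  by apply/(min_mono_gensP monoI).
have ui : (0 < u i)%N by apply: leq_ltn_trans mi.
have Ii : I 'X_[(u - U_(i))%MM] by apply: (mem_mono_le monoI) (mnm_leB1 mu mi); case: mm.
have [->|ik] := eqVneq k i; first exact: Ii.
have lik : (i < k)%N by rewrite ltn_neqAle uk1 // andbT eq_sym.
have -> : (u - U_(k) = u - U_(i) - U_(k) + U_(i))%MM.
  apply/mnmP => j; rewrite !(mnmDE, mnmBE) !mnm1E.
  by move: ui; case: (i =P j) => [<-|_]; case: eqP => [e'|]; try lia; rewrite e' eqxx in ik.
apply: st => //.
  by move: eu; rewrite (mdeg_subU ui); lia.
apply/max_varP; split; first by rewrite mnmBE mnm1E eq_sym (negbTE ik) subn0.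
by move=> j; rewrite mnmBE => h; apply: uk1; apply: leq_trans h _; rewrite leq_subr.
Qed.

Lemma reg_le_stable e : ideal_deg I <= e -> stable (trunc_ge I e) -> reg F <= e.
Proof.
move=> le_e st; have [i [d [bid ->]]] := regP; rewrite leNgt; apply/negP => lt_e.
apply: bid; apply/betti_ideal => z hz Iz cz.
(* This keeps the monomial 1 out of [z], as [koszul_acyclic] requires of constant terms. *)
have e0 : 0 <= e by apply: le_trans le_e; have [[m _ ->] _] := ideal_degP.
(* Every monomial of [z] has degree d - i > e, the range of [stable_max_var_sub]. *)
pose P (a : 'I_1) u := I 'X_[u] /\ e < (mdeg u)%:Z.
have Pz s a u : u \in msupp (z s 0 a) -> P a u.
  rewrite (ord1 a) => uz; split; first exact: (mem_monoP monoI _).1 uz.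
  by have [_] := hz _ _ _ uz; rewrite addr0; move: lt_e; lia.
have [||s a _|b Qb bE] := @koszul_acyclic K n 1 P (fun _ u => I 'X_[u]) vars z
  (@sorted_vars n) _ Pz _ cz.
- move=> a u k [Iu eu] uk uk1; apply: stable_max_var_sub le_e st Iu eu _.
  by apply/max_varP.
- by move=> *; apply: mem_vars.
- apply: memN_msupp_eq0; apply/negP => /Pz[_]; rewrite mdeg0; move: e0; lia.
by exists b => // s; apply/(mem_monoP monoI) => u; apply: Qb.
Qed.

End Regularity.

(** * Borel type and stable truncations *)

Section BorelType.
Context (K : fieldType) (n : nat).
Local Notation S := {mpoly K[n]}.
Context (I : S -> Prop) (monoI : monomial_ideal I).
Implicit Types (u v m w : 'X_{1..n}).

Lemma var_ideal_pow_deg (P : pred 'I_n) k (q : S) u :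
  ideal_pow (var_ideal P) k q -> u \in msupp q -> (k <= \sum_(i | P i) u i)%N.
Proof.
pose W u := (\sum_(i | P i) u i)%N.
have WD u1 u2 : W (u1 + u2)%MM = (W u1 + W u2)%N.
  by rewrite /W -big_split; apply: eq_bigr => i _; rewrite mnmDE.
have var (f : S) v : var_ideal P f -> v \in msupp f -> (1 <= W v)%N.
  move=> hf; have /ideal_gen_monoP h : ideal_gen (fun q : S =>
      exists2 m, (exists2 i, P i & m = U_(i)%MM) & q = 'X_[m]) f.
    by apply: ideal_gen_sub hf => _ [i Pi ->]; exists U_(i)%MM => //; exists i.
  move=> /h[_ [i Pi ->]]; rewrite lep1mP -lt0n => vi.
  by rewrite /W (bigD1 i) //= ltn_addr.
have prod j (f : 'I_j -> S) v : (forall i, var_ideal P (f i)) ->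
    v \in msupp (\prod_(i < j) f i) -> (j <= W v)%N.
  elim: j f v => [//|j IH] f v hf.
  rewrite big_ord_recl => /msuppM_le/allpairsP[[v1 v2] /= [v1f v2f ->]].
  by rewrite WD -add1n leq_add ?(var _ _ (hf _) v1f) // (IH _ _ _ v2f).
case=> s hs ->; elim: s hs => [|c s IH] hs; first by rewrite big_nil msupp0.
rewrite big_cons => /msuppD_le; rewrite mem_cat => /orP[|]; last first.
  by apply: IH => c' c's; apply: hs; rewrite inE c's orbT.
move=> /msuppM_le/allpairsP[[u1 u2] /= [_ u2c ->]].
have [f hf e] := hs c (mem_head _ _); rewrite e in u2c.
by apply: leq_trans (prod _ _ _ hf u2c) _; rewrite -/(W _) WD leq_addl.
Qed.

Lemma mem_var_ideal (P : pred 'I_n) i : P i -> var_ideal P ('X_i : S).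
Proof. by move=> Pi; rewrite -['X_i]mul1r; apply: ideal_gen_mull; exists i. Qed.

Lemma mem_var_ideal_pow (P : pred 'I_n) i k : P i ->
  ideal_pow (var_ideal P) k ('X_[(U_(i) *+ k)%MM] : S).
Proof.
move=> Pi; rewrite -['X_[_]]mul1r; apply: ideal_gen_mull.
exists (fun=> 'X_i); first by move=> _; apply: mem_var_ideal.
by rewrite prodr_const card_ord mpolyXn.
Qed.

(** Here [w] is in the saturation by x_k, hence in that by (x_1, ..., x_k), some power of which
    multiplies [w] into [I]. *)
Lemma borel_type_mono w (k i : 'I_n) : borel_type I -> I 'X_[(w + U_(k))%MM] ->
  (i <= k)%N -> exists N, I 'X_[(w + U_(i) *+ N)%MM].
Proof.
move=> bI Iwk ik; have /bI[N _ cN] : saturation I (var_ideal (pred1 k)) 'X_[w].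
  exists 1%N => // q hq; apply/(mem_monoP monoI) => u.
  move=> /msuppM_le/allpairsP[[u1 u2] /= [+ u2q ->]]; rewrite msuppX inE => /eqP->.
  have := var_ideal_pow_deg hq u2q; rewrite (big_pred1 k) // => u2k.
  apply: (mem_mono_le monoI) Iwk _; apply/mnm_lepP => j.
  by rewrite !mnmDE mnm1E leq_add2l; case: eqP => [<-|].
exists N; rewrite mpolyXD; apply: cN; exact: mem_var_ideal_pow.
Qed.

(* Growing [w] within the finitely many monomials of [K[x_1, ..., x_k]] that
   lie outside [I] above [w] ends at a socle monomial. *)
Lemma exists_socle w (k : 'I_n) :
  (forall i : 'I_n, 0 < w i -> i <= k)%N -> ~ I 'X_[w] ->
  (forall i : 'I_n, (i <= k)%N -> exists N, I 'X_[(w + U_(i) *+ N)%MM]) ->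
  exists v, [/\ (mdeg w <= mdeg v)%N, (forall i : 'I_n, 0 < v i -> i <= k)%N,
    ~ I 'X_[v] & forall i : 'I_n, (i <= k)%N -> I 'X_[(U_(i) + v)%MM]].
Proof.
move=> wk nIw hN.
have [N NE] : exists N : 'I_n -> nat, forall i : 'I_n, (i <= k)%N -> I 'X_[(w + U_(i) *+ N i)%MM].
  apply: (fin_all_exists (P := fun (i : 'I_n) N => (i <= k)%N -> I 'X_[(w + U_(i) *+ N)%MM])).
  by move=> i; have [/hN[N hi]|ki] := leqP i k; [exists N|exists 0%N].
(* An exponent of [v] at x_i above w_i + N_i would make [v] a multiple of x_i^(N_i) w, hence a
   member of [I]. *)
have bound v : (w <= v)%MM -> ~ I 'X_[v] -> (forall i : 'I_n, 0 < v i -> i <= k)%N ->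
    (mdeg v <= \sum_i (w i + N i))%N.
  move=> wv nIv vk; rewrite mdegE; apply: leq_sum => i _.
  have [->//|/vk ik] := posnP (v i).
  rewrite leqNgt; apply/negP => lt; apply: nIv; apply: (mem_mono_le monoI) (NE i ik) _.
  apply/mnm_lepP => j; rewrite mnmDE mulmnE mnm1E; case: eqP => [<-|_].
    by rewrite mul1n ltnW.
  by rewrite mul0n addn0; apply/mnm_lepP.
suff grow t v : (\sum_i (w i + N i) - mdeg v < t)%N ->
    (w <= v)%MM -> ~ I 'X_[v] -> (forall i : 'I_n, 0 < v i -> i <= k)%N ->
  exists v', [/\ (mdeg w <= mdeg v')%N, (forall i : 'I_n, 0 < v' i -> i <= k)%N,
    ~ I 'X_[v'] & forall i : 'I_n, (i <= k)%N -> I 'X_[(U_(i) + v')%MM]].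
  exact: grow (ltnSn _) (lepm_refl _) nIw wk.
elim: t v => [//|t IH] v vt wv nIv vk.
case: (classic (exists2 i : 'I_n, (i <= k)%N & ~ I 'X_[(U_(i) + v)%MM])) => [[i ik nIi]|h].
  have wv' : (w <= U_(i) + v)%MM by apply: lepm_trans wv (lem_addl _ _).
  have vk' (j : 'I_n) : (0 < (U_(i) + v)%MM j)%N -> (j <= k)%N.
    by rewrite mnmDE mnm1E; case: eqP => [<-|_] // /vk.
  have bd := bound _ wv' nIi vk'; apply: IH wv' nIi vk'.
  by move: vt bd; rewrite mdegD mdeg1; lia.
exists v; split=> //; first exact: mdeg_le.
by move=> i ik; apply: NNPP => nIi; apply: h; exists i.
Qed.

Lemma borel_stable (F : gfree_resolution I) : borel_type I -> stable (trunc_ge I (reg F)).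
Proof.
move=> bI; apply/(stable_truncP monoI) => u j k Iu ru uk jk.
have [uk0 uk1] := (max_varP _ _).1 uk; pose w := (u - U_(k))%MM.
have wk : I 'X_[(w + U_(k))%MM] by rewrite mnm_subK.
have hN (i : 'I_n) := borel_type_mono bI wk (i := i).
have w_le (i : 'I_n) : (0 < w i)%N -> (i <= k)%N.
  by rewrite mnmBE => h; apply: uk1; apply: leq_trans h (leq_subr _ _).
apply: NNPP => nI; rewrite -/w in nI.
have [v [wv vk nIv sv]] : exists v, [/\ (mdeg (w + U_(j)) <= mdeg v)%N,
    (forall i : 'I_n, 0 < v i -> i <= k)%N, ~ I 'X_[v] &
    forall i : 'I_n, (i <= k)%N -> I 'X_[(U_(i) + v)%MM]].
  apply: exists_socle => // i.
    rewrite mnmDE mnm1E addn_gt0 => /orP[/w_le //|]; case: eqP => // <- _.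
    exact: ltnW.
  move=> /hN[N IN]; exists N; apply: (mem_mono_le monoI) IN _.
  by apply/mnm_lepP => l; rewrite !mnmDE leq_add2r leq_addr.
(* This gives reg >= deg v + 1, against deg v >= deg u >= reg. *)
have := reg_ge monoI (socle_betti monoI (F := F) vk nIv sv).
by move: ru wv; rewrite mdegD mdeg1 (mdeg_subU uk0) -/w; lia.
Qed.

(* [collapse i v] dominates the monomial obtained from [v] by replacing every
   variable beyond [x_i] by [x_i]. *)
Definition collapse (i : 'I_n) v : 'X_{1..n} :=
  [multinom if (l < i)%N then v l else if l == i then mdeg v else 0%N | l < n].

(** Stability replaces the last variable by x_i, which changes neither the degree nor the collapse.
    Once no variable beyond x_i remains, the collapse is a multiple of [v]. *)
Lemma collapse_mem e (i : 'I_n) v : stable (trunc_ge I e) ->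
  I 'X_[v] -> e <= (mdeg v)%:Z -> I 'X_[collapse i v].
Proof.
move=> /(stable_truncP monoI) st.
have [N] := ubnP (\sum_(l < n | (i < l)%N) v l)%N; elim: N v => // N IH v.
rewrite ltnS => vN Iv ev.
case: (classic (exists2 l : 'I_n, (i < l)%N & (0 < v l)%N)) => [[l il vl]|h].
  have [k vk lk] := max_var_gt vl; have [vk0 _] := (max_varP _ _).1 vk.
  have ik := leq_trans il lk.
  have dE : mdeg (v - U_(k) + U_(i))%MM = mdeg v by rewrite mdegD mdeg1 addn1 -mdeg_subU.
  rewrite (_ : collapse i v = collapse i (v - U_(k) + U_(i))%MM); last first.
    apply/mnmP => m; rewrite !mnmE dE; case: ifP => // mi.
    have [-> ->] : (k == m) = false /\ (i == m) = false.
      by rewrite -!val_eqE /=; split; apply/negbTE; lia.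
    by rewrite subn0 addn0.
  apply: IH; last by rewrite dE.
    apply: leq_trans vN; rewrite (bigD1 k) //= [X in (_ < X)%N](bigD1 k) //=.
    rewrite -addSn leq_add //.
      by rewrite !(mnmDE, mnmBE) !mnm1E eqxx -(val_eqE i) (ltn_eqF ik); lia.
    apply: leq_sum => m /andP[im mk]; rewrite !(mnmDE, mnmBE) !mnm1E.
    by rewrite -(val_eqE i) (ltn_eqF im); lia.
  exact: st.
apply: (mem_mono_le monoI) Iv _; apply/mnm_lepP => l; rewrite mnmE.
case: ltngtP => [//|il|/val_inj->].
  rewrite (_ : (l == i) = false); last by apply/negbTE; rewrite -val_eqE gtn_eqF.
  by rewrite leqn0 eqn0Ngt; apply/negP => vl; apply: h; exists l.
by rewrite eqxx mdegE (bigD1 i) //= leq_addr.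
Qed.

Lemma stable_borel e : stable (trunc_ge I e) -> borel_type I.
Proof.
move=> st j p; split=> -[N N1 cN].
  have Ip u : u \in msupp p -> I 'X_[(u + U_(j) *+ N)%MM].
    move=> up; have := cN _ (mem_var_ideal_pow (P := pred1 j) N (eqxx j)).
    move/(mem_monoP monoI); apply.
    by rewrite mcoeff_msupp addmC mcoeffMX -mcoeff_msupp.
  (* Adding |e| lifts deg v to at least [e]; [B] exceeds deg v for all monomials of [p] at once, so
     x_i^B u is a multiple of the collapse of [v]. *)
  pose N' := (N + `|e|)%N; pose B := (msize p + N')%N.
  have B_mem u (i : 'I_n) : u \in msupp p -> (i <= j)%N -> I 'X_[(u + U_(i) *+ B)%MM].
    move=> up ij; pose v := (u + U_(j) *+ N')%MM.
    have vd : mdeg v = (mdeg u + N')%N by rewrite mdegD mdegMn mdeg1 mul1n.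
    have Iv : I 'X_[v].
      apply: (mem_mono_le monoI) (Ip u up) _; apply/mnm_lepP => l.
      by rewrite !mnmDE !mulmnE leq_add2l leq_mul2l leq_addr orbT.
    have := collapse_mem i st Iv _; rewrite vd => /(_ _)/(mem_mono_le monoI); apply.
      by rewrite /N'; lia.
    apply/mnm_lepP => l; rewrite mnmE !mnmDE !mulmnE !mnm1E vd.
    case: ltngtP => [li|il|/val_inj->]; last 1 first.
    - rewrite eqxx mul1n; apply: leq_trans (leq_addl _ _).
      by rewrite leq_add2r ltnW // msize_mdeg_lt.
    - rewrite (_ : (j == l) = false) ?mul0n ?addn0 ?leq_addr //.
      by apply/negbTE; rewrite -val_eqE gtn_eqF // (leq_trans li).
    - by rewrite -val_eqE gtn_eqF.
  (* Pigeonhole: more than n B factors among at most [n] variables force some exponent to reach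
     [B]. *)
  exists (n * B).+1 => // q hq; apply/(mem_monoP monoI) => m.
  move=> /msuppM_le/allpairsP[[u v] /= [up vq ->]].
  have := var_ideal_pow_deg hq vq => vB.
  have [i ij Bi] : exists2 i : 'I_n, (i <= j)%N & (B <= v i)%N.
    apply: NNPP => h; move: vB; apply/negP; rewrite -leqNgt.
    apply: leq_trans (_ : \sum_(i < n | (i <= j)%N) B <= _)%N.
      apply: leq_sum => i ij; rewrite leqNgt; apply/negP => Bi; apply: h.
      by exists i => //; apply: ltnW.
    by rewrite sum_nat_const leq_mul2r -[X in (_ <= X)%N]card_ord max_card orbT.
  apply: (mem_mono_le monoI) (B_mem u i up ij) _; apply/mnm_lepP => l.
  by rewrite !mnmDE mulmnE mnm1E leq_add2l; case: eqP => [<-|_]; rewrite ?mul1n // mul0n.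
exists N => // q; case=> s hs ->.
apply: cN; exists s => // c /hs[f hf ->]; exists f => // i.
by apply: ideal_gen_sub (hf i) => _ [l /eqP-> ->]; exists j.
Qed.

End BorelType.

Theorem theorem1p5 (K : fieldType) (infK : infinite_type K)
    (n : nat) (n_ge2 : (2 <= n)%N)
    (I : {mpoly K[n]} -> Prop) (monoI : monomial_ideal I)
    (I_neq0 : exists2 p, I p & p != 0)
    (F : gfree_resolution I) :
  [/\ borel_type I <-> stable (trunc_ge I (reg F)),
      stable (trunc_ge I (reg F)) <->
        (exists2 e : int, ideal_deg I <= e & stable (trunc_ge I e))
    & borel_type I \/ stable (trunc_ge I (reg F)) \/
        (exists2 e : int, ideal_deg I <= e & stable (trunc_ge I e)) ->
      is_minz (fun e : int => ideal_deg I <= e /\ stable (trunc_ge I e))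
        (reg F)].
Proof.
have le_reg := ideal_deg_le_reg monoI F I_neq0.
have b2 : borel_type I -> stable (trunc_ge I (reg F)) := @borel_stable _ _ _ monoI F.
(* Stability of any truncation returns to Borel type, which links all three conditions. *)
have sb e : stable (trunc_ge I e) -> borel_type I := @stable_borel _ _ _ monoI e.
split.
- by split=> [/b2|/sb].
- by split=> [st|[e _ /sb/b2]//]; exists (reg F).
move=> h; split=> [|e [le_e st]]; last exact: reg_le_stable le_e st.
split=> //; apply: b2; case: h => [//|[/sb//|[e _ /sb//]]].
Qed.
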